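(* Let $\mathcal{M}$ be the class of all positive contractions $T$ on $\ell_2$ such that: (1) $\|T\|=1$; and (2) there exists a family $(u_r)_{r\in J}$ of norming vectors for $T^*$, indexed by a set $J\subseteq\mathbb{Z}_+$, such that $u_r\ge 0$ and $\|u_r\|=1$ for every $r\in J$, and $\bigcup_{r\in J}\mathrm{Supp}(u_r)=\mathbb{Z}_+$. Then every operator in $\mathcal{M}$ is a point of continuity of both identity maps $(\mathcal{P}_1(\ell_2),\mathrm{WOT})\to(\mathcal{P}_1(\ell_2),\mathrm{SOT}_* )$ and $(\mathcal{P}_1(\ell_2),\mathrm{SOT})\to(\mathcal{P}_1(\ell_2),\mathrm{SOT}^* )$.
   Context: $\ell_2=\ell_2(\mathbb{Z}_+)$ is the complex sequence space, $\mathbb{Z}_+=\{0,1,2,\dots\}$, with canonical basis $(e_n)_{n\ge 0}$. A vector $x=\sum_n x_n e_n$ is positive ($x\ge 0$) if $x_n\ge 0$ for all $n$; a bounded operator $T$ on $\ell_2$ is positive if $Tx\ge 0$ whenever $x\ge 0$; a positive contraction is a positive operator $T$ with $\|T\|\le 1$, and $\mathcal{P}_1(\ell_2)$ is the set of all positive contractions. For a vector $u$, $\mathrm{Supp}(u)=\{j\ge 0:\langle e_j,u\rangle\ne 0\}$. A vector $x\neq 0$ is norming for an operator $S$ if $\|Sx\|=\|S\|\,\|x\|$. The topologies on $\mathcal{P}_1(\ell_2)$ are: WOT: $T_i\to T$ iff $\langle y,T_ix\rangle\to\langle y,Tx\rangle$ for all $x,y$; SOT: $T_i\to T$ iff $\|T_ix-Tx\|\to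 0$ for all $x$; SOT$_*$: $T_i\to T$ iff $\|T_i^*y-T^*y\|\to 0$ for all $y$; SOT$^*$: $T_i\to T$ iff both $T_i\to T$ in SOT and $T_i\to T$ in SOT$_*$. *)

(* Defs.v *)
From HB Require Import structures.
From mathcomp Require Import all_boot all_order all_algebra.
From mathcomp Require Import all_classical all_reals all_analysis.
From mathcomp Require Import complex ring.

Set Implicit Arguments.
Unset Strict Implicit.
Unset Printing Implicit Defensive.
Import Order.TTheory GRing.Theory Num.Theory.
Import numFieldNormedType.Exports.
Import ComplexField.Normc.

Local Open Scope classical_set_scope.
Local Open Scope ring_scope.
Local Open Scope complex_scope.

(* MathComp-Analysis equips the regular module [R[i]^o] with the usual
   topology, but not [R[i]] itself. *)
HB.instance Definition _ (R : realType) := NormedModule.copy R[i] R[i]^o.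

Section ell2_type.
Context (R : realType).
Local Notation C := R[i].
Implicit Types x y : nat -> C.

Definition sqsum x : R ^nat := series (fun n => normc (x n) ^+ 2).

Definition square_summable : {pred nat -> C} := fun x => `[< cvgn (sqsum x) >].

Lemma sqsum_nd x : nondecreasing_seq (sqsum x).
Proof.
by apply/nondecreasing_seqP => n; rewrite /sqsum seriesEnat /= big_nat_recr//= lerDl sqr_ge0.
Qed.

Lemma sqsum_ge0 x n : 0 <= sqsum x n.
Proof. by rewrite /sqsum seriesEnat/= sumr_ge0// => i _; rewrite sqr_ge0. Qed.

Lemma sqsumS x n : sqsum x n.+1 = sqsum x n + normc (x n) ^+ 2.
Proof. by rewrite /sqsum seriesEnat /= big_nat_recr. Qed.

Lemma sqsum_bounded x (M : R) :
  (forall n, sqsum x n <= M) -> cvgn (sqsum x).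
Proof.
move=> h; apply: nondecreasing_is_cvgn; first exact: sqsum_nd.
by exists M => _ [n _ <-].
Qed.

Lemma normc_ge0 (z : C) : 0 <= normc z.
Proof. by case: z => a b; rewrite /normc sqrtr_ge0. Qed.

Lemma le_hypotD (s t a b : R) : Num.sqrt ((s + t) ^+ 2 + (a + b) ^+ 2) <=
  Num.sqrt (s ^+ 2 + a ^+ 2) + Num.sqrt (t ^+ 2 + b ^+ 2).
Proof. exact: (le_normcD (s +i* a) (t +i* b)). Qed.

Lemma sqsumD_sqrt x y n : Num.sqrt (sqsum (x + y) n) <=
  Num.sqrt (sqsum x n) + Num.sqrt (sqsum y n).
Proof.
elim: n => [|n IH].
  by rewrite /sqsum !seriesEnat /= !big_geq// sqrtr0 addr0.
rewrite !sqsumS.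
set s := Num.sqrt (sqsum x n) in IH *; set t := Num.sqrt (sqsum y n) in IH *.
have -> : sqsum x n = s ^+ 2 by rewrite sqr_sqrtr// sqsum_ge0.
have -> : sqsum y n = t ^+ 2 by rewrite sqr_sqrtr// sqsum_ge0.
apply: le_trans (le_hypotD _ _ _ _); apply: ler_wsqrtr; apply: lerD.
  rewrite -[leLHS]sqr_sqrtr ?sqsum_ge0//.
  by rewrite lerXn2r// nnegrE ?addr_ge0 ?sqrtr_ge0.
by rewrite lerXn2r// ?nnegrE ?addr_ge0 ?normc_ge0//; exact: le_normcD.
Qed.

Lemma sqsumZ (a : C) x n : sqsum (a *: x) n = normc a ^+ 2 * sqsum x n.
Proof.
rewrite /sqsum !seriesEnat /= mulr_sumr; apply: eq_bigr => i _.
by rewrite -exprMn -normcM.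
Qed.

Lemma square_summable_le x n : cvgn (sqsum x) -> sqsum x n <= limn (sqsum x).
Proof. by move=> cx; apply: nondecreasing_cvgn_le => //; exact: sqsum_nd. Qed.

Lemma square_summable_submod : submod_closed square_summable.
Proof.
split=> [|a x y /asboolP cx /asboolP cy]; apply/asboolP.
  apply: (@sqsum_bounded _ 0) => n.
  rewrite /sqsum seriesEnat /= big1// => i _.
  by rewrite [X in X ^+ _](@normc0 R) expr0n.
pose M := normc a ^+ 2 * limn (sqsum x); pose N := limn (sqsum y).
apply: (@sqsum_bounded _ ((Num.sqrt M + Num.sqrt N) ^+ 2)) => n.
rewrite -[leLHS]sqr_sqrtr ?sqsum_ge0// lerXn2r ?nnegrE ?addr_ge0 ?sqrtr_ge0//.
apply: (le_trans (sqsumD_sqrt _ _ _)); apply: lerD; apply: ler_wsqrtr.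
  by rewrite sqsumZ ler_wpM2l ?sqr_ge0//; exact: square_summable_le.
exact: square_summable_le.
Qed.

HB.instance Definition _ :=
  GRing.isSubmodClosed.Build _ _ square_summable square_summable_submod.

Record ell2 := Ell2 { ell2_val :> nat -> C ; _ : ell2_val \in square_summable }.

HB.instance Definition _ := [isSub for ell2_val].
HB.instance Definition _ := [Choice of ell2 by <:].
HB.instance Definition _ := [SubChoice_isSubLmodule of ell2 by <:].

Definition l2norm (x : ell2) : R := Num.sqrt (limn (sqsum x)).

Lemma ell2P (x : ell2) : cvgn (sqsum x).
Proof. by case: x => x /= /asboolP. Qed.

Lemma ell2_sqsum_le (x : ell2) n : sqsum x n <= l2norm x ^+ 2.
Proof.
have cx := @ell2P x; rewrite sqr_sqrtr; first exact: square_summable_le.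
by rewrite (le_trans _ (@square_summable_le x 0%N cx)) ?sqsum_ge0.
Qed.

Lemma l2norm_ge0 (x : ell2) : 0 <= l2norm x.
Proof. exact: sqrtr_ge0. Qed.

Lemma ell2_sqsum_sqrt_le (x : ell2) n : Num.sqrt (sqsum x n) <= l2norm x.
Proof.
by rewrite -[leRHS]ger0_norm ?l2norm_ge0// -sqrtr_sqr ler_wsqrtr// ell2_sqsum_le.
Qed.

Lemma l2norm_le (x : ell2) (M : R) : 0 <= M ->
  (forall n, Num.sqrt (sqsum x n) <= M) -> l2norm x <= M.
Proof.
move=> M0 h; rewrite -[M]ger0_norm// -sqrtr_sqr ler_wsqrtr//.
apply: limr_le; first exact: ell2P.
apply: nearW => n; rewrite -[leLHS]sqr_sqrtr ?sqsum_ge0//.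
by rewrite lerXn2r// nnegrE ?sqrtr_ge0.
Qed.

Lemma l2normD (x y : ell2) : l2norm (x + y) <= l2norm x + l2norm y.
Proof.
apply: l2norm_le => [|n]; first by rewrite addr_ge0 ?l2norm_ge0.
apply: (le_trans (sqsumD_sqrt _ _ _)).
by apply: lerD; exact: ell2_sqsum_sqrt_le.
Qed.

Lemma l2normZ (a : C) (x : ell2) : l2norm (a *: x) = normc a * l2norm x.
Proof.
have -> : normc a * l2norm x = Num.sqrt (normc a ^+ 2 * limn (sqsum x)).
  by rewrite sqrtrM ?sqr_ge0// sqrtr_sqr ger0_norm ?normc_ge0.
rewrite /l2norm; congr Num.sqrt; apply/cvg_lim => //.
rewrite (_ : sqsum _ = fun n => normc a ^+ 2 * sqsum x n); last first.
  by apply/funext => n; exact: sqsumZ.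
by apply: cvgM; [exact: cvg_cst|exact: ell2P].
Qed.

Lemma normc_le_l2norm (x : ell2) n : normc (x n) <= l2norm x.
Proof.
rewrite -ler_sqr ?nnegrE ?normc_ge0 ?l2norm_ge0//.
by apply: le_trans (ell2_sqsum_le x n.+1); rewrite sqsumS lerDr sqsum_ge0.
Qed.

Lemma l2norm_eq0 (x : ell2) : l2norm x = 0 -> x = 0.
Proof.
move=> x0; apply/val_inj/funext => n /=; apply/eq0_normc/eqP.
by rewrite eq_le normc_ge0 andbT -x0 normc_le_l2norm.
Qed.

Let norml2 (x : ell2) : C := (l2norm x)%:C.

Let norml2D (x y : ell2) : norml2 (x + y) <= norml2 x + norml2 y.
Proof. by rewrite /norml2 -rmorphD lecR l2normD. Qed.

Let norml2Z (a : C) (x : ell2) : norml2 (a *: x) = `|a| * norml2 x.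
Proof. by rewrite /norml2 l2normZ rmorphM; case: a. Qed.

Let norml2_eq0 (x : ell2) : norml2 x = 0 -> x = 0.
Proof. by move=> /complexI; exact: l2norm_eq0. Qed.

HB.instance Definition _ :=
  Lmodule_isNormed.Build C ell2 norml2D norml2Z norml2_eq0.

Lemma normE (x : ell2) : `|x| = (l2norm x)%:C.
Proof. by []. Qed.

End ell2_type.

Section complex_limits.
Context (R : realType).
Local Notation C := R[i].

Lemma gt0C (e : C) : 0 < e -> exists2 r : R, 0 < r & e = r%:C.
Proof.
case: e => a b; rewrite ltcE /= => /andP[/eqP -> a0].
by exists a.
Qed.

Lemma normc_le_ReIm (z : C) :
  normc z <= `|complex.Re z| + `|complex.Im z|.
Proof.
case: z => a b /=.
rewrite -[leRHS]ger0_norm ?addr_ge0// -sqrtr_sqr ler_wsqrtr//.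
rewrite sqrrD !real_normK ?num_real// -addrA [X in _ <= _ + X]addrC addrA lerDl.
by rewrite mulrn_wge0// mulr_ge0.
Qed.

Lemma normc_geRe (z : C) : `|complex.Re z| <= normc z.
Proof. by rewrite -lecR; exact: normc_ge_Re. Qed.

Lemma normc_geIm (z : C) : `|complex.Im z| <= normc z.
Proof.
case: z => a b /=; rewrite -sqrtr_sqr ler_wsqrtr//.
by rewrite lerDr sqr_ge0.
Qed.

Lemma ltc_normE (z : C) (e : R) : (`|z| < e%:C) = (normc z < e).
Proof. by case: z => a b; rewrite -ltcR. Qed.

Lemma cvgC_normc (u : nat -> C) (l : C) :
  (fun n => normc (l - u n)) @ \oo --> (0 : R) <-> u @ \oo --> l.
Proof.
split=> [/cvgrPdist_lt h|/cvgrPdist_lt h]; apply/cvgrPdist_lt.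
  move=> _ /gt0C[e e0 ->]; near=> n; apply: (etrans (ltc_normE _ _)).
  near: n; apply: filterS (h e e0) => n.
  by rewrite sub0r normrN ger0_norm ?normc_ge0.
move=> e e0; have := h e%:C; rewrite ltcR => /(_ e0); apply: filterS => n.
move=> /(etrans (esym (ltc_normE _ _))).
by rewrite sub0r normrN ger0_norm ?normc_ge0.
Unshelve. all: by end_near. Qed.

Lemma cvgC_ReIm (u : nat -> C) (a b : R) :
  (@complex.Re R \o u) @ \oo --> a -> (@complex.Im R \o u) @ \oo --> b ->
  u @ \oo --> (a +i* b).
Proof.
have H (v : R ^nat) c : v @ \oo --> c -> (fun n => `|c - v n|) @ \oo --> (0 : R).
  move=> vc; rewrite -[X in _ --> X](@normr0 _ R) -(subrr c).
  by apply: cvg_norm; apply: cvgB => //; exact: cvg_cst.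
move=> ua ub; apply/cvgC_normc.
apply: (@squeeze_cvgr _ _ _ _ (cst 0)
  (fun n => `|a - complex.Re (u n)| + `|b - complex.Im (u n)|)).
- near=> n; rewrite /= normc_ge0/=.
  by case: (u n) => c d; exact: normc_le_ReIm.
- exact: cvg_cst.
- rewrite -[X in _ --> X](addr0 (0:R)); apply: cvgD.
    exact: H.
  exact: H.
Unshelve. all: by end_near. Qed.

Lemma series_Re (u : nat -> C) : @complex.Re R \o series u = series (@complex.Re R \o u).
Proof.
apply/funext => n; rewrite /= !seriesEnat/=.
elim: n => [|n IH]; first by rewrite !big_geq.
rewrite !big_nat_recr//= -IH; by case: (\sum_(_ <= _ < _) _); case: (u n).
Qed.

Lemma series_Im (u : nat -> C) : @complex.Im R \o series u = series (@complex.Im R \o u).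
Proof.
apply/funext => n; rewrite /= !seriesEnat/=.
elim: n => [|n IH]; first by rewrite !big_geq.
rewrite !big_nat_recr//= -IH; by case: (\sum_(_ <= _ < _) _); case: (u n).
Qed.

Lemma abs_cvg_seriesC (u : nat -> C) :
  cvgn (series (@normc R \o u)) -> cvgn (series u).
Proof.
move=> cu; apply/cvg_ex.
have cRe : cvgn (series (@complex.Re R \o u)).
  apply: normed_cvg; apply: series_le_cvg cu => n //=.
    exact: normc_ge0.
  exact: normc_geRe.
have cIm : cvgn (series (@complex.Im R \o u)).
  apply: normed_cvg; apply: series_le_cvg cu => n //=.
    exact: normc_ge0.
  exact: normc_geIm.
eexists; apply: cvgC_ReIm; [rewrite series_Re; exact: cRe|rewrite series_Im; exact: cIm].
Qed.

End complex_limits.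

Section inner_product.
Context (R : realType).
Local Notation C := R[i].
Local Notation l2 := (ell2 R).
Implicit Types x y : l2.

(* linear in the second argument, antilinear in the first *)
Definition dotp x y : C := limn (series (fun n => (x n)^* * y n)).

Lemma normc_conj (z : C) : normc z^* = normc z.
Proof. by case: z => a b /=; rewrite sqrrN. Qed.

Lemma dotp_normc_sum (x y : nat -> C) n :
  \sum_(0 <= i < n) normc ((x i)^* * y i) <=
    Num.sqrt (sqsum x n) * Num.sqrt (sqsum y n).
Proof.
elim: n => [|n IH]; first by rewrite big_geq// mulr_ge0 ?sqrtr_ge0.
rewrite big_nat_recr//= !sqsumS normcM normc_conj.
set s := Num.sqrt (sqsum x n) in IH *; set t := Num.sqrt (sqsum y n) in IH *.
have -> : sqsum x n = s ^+ 2 by rewrite sqr_sqrtr// sqsum_ge0.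
have -> : sqsum y n = t ^+ 2 by rewrite sqr_sqrtr// sqsum_ge0.
set a := normc (x n); set b := normc (y n).
apply: (@le_trans _ _ (s * t + a * b)); first by rewrite lerD2r.
rewrite -sqrtrM ?addr_ge0 ?sqr_ge0//.
rewrite -[leLHS]ger0_norm ?addr_ge0 ?mulr_ge0 ?sqrtr_ge0 ?normc_ge0//.
rewrite -sqrtr_sqr ler_wsqrtr// -subr_ge0.
have -> : (s ^+ 2 + a ^+ 2) * (t ^+ 2 + b ^+ 2) - (s * t + a * b) ^+ 2 =
  (s * b - a * t) ^+ 2 by ring.
exact: sqr_ge0.
Qed.

Lemma dotp_normc_sum_le x y n :
  \sum_(0 <= i < n) normc ((x i)^* * y i) <= l2norm x * l2norm y.
Proof.
apply: (le_trans (dotp_normc_sum _ _ _)).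
by apply: ler_pM; rewrite ?sqrtr_ge0//; exact: ell2_sqsum_sqrt_le.
Qed.

Lemma is_cvg_dotp x y : cvgn (series (fun n => (x n)^* * y n)).
Proof.
apply: abs_cvg_seriesC; apply: nondecreasing_is_cvgn.
  apply/nondecreasing_seqP => n.
  by rewrite !seriesEnat /= big_nat_recr//= lerDl normc_ge0.
exists (l2norm x * l2norm y) => _ [n _ <-].
by rewrite seriesEnat/=; exact: dotp_normc_sum_le.
Qed.

Lemma normc_sum_le (u : nat -> C) n :
  normc (\sum_(0 <= i < n) u i) <= \sum_(0 <= i < n) normc (u i).
Proof.
elim: n => [|n IH]; first by rewrite !big_geq// normc0.
by rewrite !big_nat_recr//= (le_trans (le_normcD _ _))// lerD2r.
Qed.

Lemma CauchySchwarz_dotp x y : normc (dotp x y) <= l2norm x * l2norm y.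
Proof.
have /cvgC_normc h := @is_cvg_dotp x y.
rewrite -[leRHS]addr0; apply/ler_addgt0Pr => e e0.
have /cvgrPdist_lt/(_ e e0) [n _ /(_ n (leqnn n))] := h.
rewrite sub0r normrN ger0_norm ?normc_ge0// => /ltW he.
rewrite -[X in normc X](subrK (series (fun n => (x n)^* * y n) n)).
rewrite (le_trans (le_normcD _ _))// addr0 addrC lerD//.
rewrite seriesEnat (le_trans (normc_sum_le _ _))//.
exact: dotp_normc_sum_le.
Qed.

Lemma dotp_linear x : linear_for *%R (dotp x).
Proof.
move=> a y z; apply/cvg_lim => //.
rewrite (_ : series _ = fun n => a * series (fun n => (x n)^* * y n) n +
    series (fun n => (x n)^* * z n) n).
  by apply: cvgD; [apply: cvgM; [exact: cvg_cst|]|]; exact: is_cvg_dotp.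
apply/funext => n; rewrite !seriesEnat/= mulr_sumr -big_split /=.
by apply: eq_bigr => i _; rewrite mulrDr mulrCA.
Qed.

Lemma dotpC x y : dotp y x = (dotp x y)^*.
Proof.
apply/cvg_lim => //; apply/cvgC_normc.
have /cvgC_normc := @is_cvg_dotp x y; apply: cvg_trans; apply: near_eq_cvg.
near=> n; rewrite -normc_conj rmorphB /=; congr (normc (_ - _)).
rewrite !seriesEnat/= rmorph_sum; apply: eq_bigr => i _.
by rewrite rmorphM/= conjcK mulrC.
Unshelve. all: by end_near. Qed.

End inner_product.

Section bounded_operators.
Context (R : realType).
Local Notation C := R[i].
Local Notation l2 := (ell2 R).

Lemma sqsum_delta (k n : nat) :
  sqsum (fun i => (i == k)%:R : C) n = (k < n)%N%:R.
Proof.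
elim: n => [|n IH]; first by rewrite /sqsum seriesEnat/= big_geq.
rewrite sqsumS IH ltnS; case: (ltngtP n k) => nk.
- by rewrite [normc _]normc0 expr0n addr0.
- by rewrite [normc _]normc0 expr0n addr0.
- by rewrite [normc _]normc1 expr1n add0r.
Qed.

Lemma square_summable_delta (k : nat) :
  (fun i => (i == k)%:R : C) \in @square_summable R.
Proof.
apply/asboolP; apply: (@sqsum_bounded _ _ 1) => n.
by rewrite sqsum_delta; case: (k < n)%N.
Qed.

Definition ebasis (k : nat) : l2 := Ell2 (square_summable_delta k).

Lemma dotp_ebasis (k : nat) (x : l2) : dotp (ebasis k) x = x k.
Proof.
apply/cvg_lim => //; apply/cvgC_normc.
apply: cvg_near_cst; exists k.+1 => // n /= kn.
rewrite seriesEnat/=.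
have -> : \sum_(0 <= i < n) ((i == k)%:R^* * x i) = x k.
  rewrite big_mkord (bigD1 (Ordinal kn))//= eqxx big1 ?addr0; last first.
    by move=> i; rewrite -val_eqE/= => /negbTE ->; rewrite rmorph0 mul0r.
  by rewrite rmorph1 mul1r.
by rewrite subrr normc0.
Qed.

Definition trunc (s : nat -> C) (N : nat) : l2 :=
  \sum_(0 <= k < N) s k *: ebasis k.

Lemma truncE s N n : trunc s N n = if (n < N)%N then s n else 0.
Proof.
elim: N => [|N IH]; first by rewrite /trunc big_geq.
transitivity (trunc s N n + s N * (n == N)%:R).
  by rewrite /trunc big_nat_recr.
rewrite IH ltnS.
case: (ltngtP n N) => nN; first by rewrite mulr0 addr0.
  by rewrite mulr0 addr0.
by rewrite mulr1 add0r nN.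
Qed.

Lemma sqsum_trunc s N n : sqsum (trunc s N) n = sqsum s (minn n N).
Proof.
elim: n => [|n IH]; first by rewrite min0n /sqsum !seriesEnat/= !big_geq.
rewrite sqsumS IH truncE; case: ltnP => nN.
  by rewrite (minn_idPl nN) sqsumS.
by rewrite normc0 expr0n/= addr0 (minn_idPr (leqW nN)).
Qed.

Lemma sqsum_sub_trunc (s : nat -> C) N n :
  sqsum (s - (trunc s N : nat -> C)) n + sqsum s (minn n N) = sqsum s n.
Proof.
elim: n => [|n IH]; first by rewrite min0n /sqsum !seriesEnat/= !big_geq// addr0.
have E : (s - (trunc s N : nat -> C)) n = if (n < N)%N then 0 else s n.
  transitivity (s n - trunc s N n) => //.
  by rewrite truncE; case: ifP; rewrite ?subrr ?subr0.
rewrite !sqsumS -IH E; case: ltnP => nN.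
  by rewrite (minn_idPl nN) sqsumS normc0 expr0n/= addr0 addrA.
by rewrite (minn_idPr (leqW nN)) addrAC.
Qed.

Lemma l2norm_trunc_le s N : l2norm (trunc s N) <= Num.sqrt (sqsum s N).
Proof.
apply: l2norm_le => [|n]; first exact: sqrtr_ge0.
by rewrite sqsum_trunc ler_wsqrtr// sqsum_nd// geq_minr.
Qed.

Lemma cvg_trunc (x : l2) : (fun N => l2norm (x - trunc x N)) @ \oo --> (0 : R).
Proof.
apply: (@squeeze_cvgr _ _ _ _ (cst 0)
  (fun N => Num.sqrt (limn (sqsum x) - sqsum x N))).
- near=> N; rewrite l2norm_ge0/=; apply: l2norm_le => [|n].
    exact: sqrtr_ge0.
  apply: ler_wsqrtr; apply: (@le_trans _ _ (sqsum (x - trunc x N) (n + N)%N)).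
    by apply: sqsum_nd; rewrite leq_addr.
  rewrite lerBrDr.
  have := sqsum_sub_trunc x N (n + N); rewrite (minn_idPr (leq_addl _ _)) => ->.
  by apply: square_summable_le; exact: ell2P.
- exact: cvg_cst.
- rewrite -(sqrtr0 R) -(subrr (limn (sqsum x))).
  apply: (@cvg_comp _ _ _ (fun N => limn (sqsum x) - sqsum x N) Num.sqrt).
    by apply: cvgB; [exact: cvg_cst|exact: ell2P].
  exact: sqrt_continuous.
Unshelve. all: by end_near. Qed.

Record bounded_op := BoundedOp {
  bop_fun :> {linear l2 -> l2} ;
  bop_bounded : exists M : R, forall x, l2norm (bop_fun x) <= M * l2norm x }.

(* the set is nonempty and bounded above by [bop_bounded], so [sup] is genuine *)
Definition opnorm (T : bounded_op) : R :=
  sup [set l2norm (T x) | x in [set x | l2norm x <= 1]].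

Section adjoint.
Variable T : bounded_op.

Lemma dotpD (x y z : l2) : dotp x (y + z) = dotp x y + dotp x z.
Proof. by have := dotp_linear x 1 y z; rewrite scale1r mul1r. Qed.

Lemma dotp0 (x : l2) : dotp x 0 = 0.
Proof. by apply: (@addrI _ (dotp x 0)); rewrite -dotpD !addr0. Qed.

Lemma dotpZ (x y : l2) (a : C) : dotp x (a *: y) = a * dotp x y.
Proof. by have := dotp_linear x a y 0; rewrite dotp0 !addr0. Qed.

Lemma dotp_trunc (y : l2) s N : dotp y (T (trunc s N)) =
  \sum_(0 <= k < N) s k * dotp y (T (ebasis k)).
Proof.
rewrite /trunc; elim: N => [|N IH]; first by rewrite !big_geq// linear0 dotp0.
by rewrite !big_nat_recr//= linearD dotpD IH linearZ dotpZ.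
Qed.

(* coordinates of the adjoint: (T^* y)_k = <T e_k, y> *)
Definition adjoint_seq (y : l2) : nat -> C := fun k => dotp (T (ebasis k)) y.

Lemma bop_bounded0 : exists2 M : R, 0 <= M &
  forall x, l2norm (T x) <= M * l2norm x.
Proof.
have [M hM] := bop_bounded T; exists `|M| => // x.
by rewrite (le_trans (hM x))// ler_wpM2r ?l2norm_ge0// ler_norm.
Qed.

Lemma adjoint_seq_le (M : R) (y : l2) N : 0 <= M ->
  (forall x, l2norm (T x) <= M * l2norm x) ->
  Num.sqrt (sqsum (adjoint_seq y) N) <= M * l2norm y.
Proof.
move=> M0 hM; set s := adjoint_seq y; set A := Num.sqrt _.
have [->|A0] := eqVneq A 0; first by rewrite mulr_ge0 ?l2norm_ge0.
have {}A0 : 0 < A by rewrite lt_neqAle eq_sym A0 sqrtr_ge0.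
have h : dotp y (T (trunc s N)) = (A ^+ 2)%:C.
  rewrite dotp_trunc sqr_sqrtr ?sqsum_ge0// /sqsum seriesEnat/= rmorph_sum.
  apply: eq_bigr => k _; rewrite dotpC -[X in _ * X^*]/(s k).
  by rewrite -sqr_normc rmorphXn; case: (s k).
have := CauchySchwarz_dotp y (T (trunc s N)); rewrite h.
rewrite [leLHS]/= expr0n/= addr0 sqrtr_sqr ger0_norm ?sqr_ge0// expr2.
move=> hA; rewrite -(ler_pM2r A0) (le_trans hA)// [leRHS]mulrAC [leRHS]mulrC.
rewrite ler_wpM2l ?l2norm_ge0// (le_trans (hM _))// ler_wpM2l//.
exact: l2norm_trunc_le.
Qed.

Lemma square_summable_adjoint (y : l2) :
  adjoint_seq y \in @square_summable R.
Proof.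
have [M M0 hM] := bop_bounded0.
apply/asboolP; apply: (@sqsum_bounded _ _ ((M * l2norm y) ^+ 2)) => n.
rewrite -[leLHS]sqr_sqrtr ?sqsum_ge0//.
rewrite lerXn2r ?nnegrE ?sqrtr_ge0 ?mulr_ge0 ?l2norm_ge0//.
exact: adjoint_seq_le.
Qed.

Definition adjoint_fun (y : l2) : l2 := Ell2 (square_summable_adjoint y).

Lemma adjoint_linear : linear adjoint_fun.
Proof.
move=> a y z; apply/val_inj/funext => k.
exact: (dotp_linear (T (ebasis k)) a y z).
Qed.

HB.instance Definition _ :=
  GRing.isLinear.Build C l2 l2 *:%R adjoint_fun adjoint_linear.

Lemma adjoint_bounded :
  exists M : R, forall x, l2norm (adjoint_fun x) <= M * l2norm x.
Proof.
have [M M0 hM] := bop_bounded0; exists M => y.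
apply: l2norm_le => [|n]; first by rewrite mulr_ge0 ?l2norm_ge0.
exact: adjoint_seq_le.
Qed.

Definition adjoint : bounded_op := BoundedOp adjoint_bounded.

Lemma adjointP (x y : l2) : dotp y (T x) = dotp (adjoint y) x.
Proof.
apply/esym/cvg_lim => //; apply/cvgC_normc.
have [M M0 hM] := bop_bounded0.
apply: (@squeeze_cvgr _ _ _ _ (cst 0)
  (fun N => l2norm y * M * l2norm (x - trunc x N))).
- near=> N; rewrite normc_ge0/=.
  have -> : series (fun n => (adjoint y n)^* * x n) N = dotp y (T (trunc x N)).
    rewrite dotp_trunc seriesEnat/=; apply: eq_bigr => k _.
    by rewrite mulrC [in RHS]dotpC.
  have -> : dotp y (T x) - dotp y (T (trunc x N)) = dotp y (T (x - trunc x N)).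
    by rewrite -[X in X - _](subrK (dotp y (T (trunc x N)))) linearB -[in RHS]scaleN1r dotpD dotpZ mulN1r addrK.
  rewrite (le_trans (CauchySchwarz_dotp _ _))// -mulrA ler_wpM2l ?l2norm_ge0//.
- exact: cvg_cst.
- rewrite -[X in _ --> X](mulr0 (l2norm y * M)).
  by apply: cvgM; [exact: cvg_cst|exact: cvg_trunc].
Unshelve. all: by end_near. Qed.

End adjoint.

End bounded_operators.

Section positive_contractions.
Context (R : realType).
Local Notation C := R[i].
Local Notation l2 := (ell2 R).

Definition nonneg_vec (x : l2) : Prop := forall n, 0 <= x n.

Definition positive_op (T : bounded_op R) : Prop :=
  forall x, nonneg_vec x -> nonneg_vec (T x).

Definition Supp (u : l2) : set nat := [set j | dotp (ebasis R j) u != 0].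

Definition norming (S : bounded_op R) (x : l2) : Prop :=
  x != 0 /\ l2norm (S x) = opnorm S * l2norm x.

(* the set $\mathcal{P}_1(\ell_2)$ of positive contractions *)
Record P1 := PosContraction {
  P1_op :> bounded_op R ;
  P1_positive : positive_op P1_op ;
  P1_contraction : opnorm P1_op <= 1 }.

HB.instance Definition _ := gen_eqMixin P1.
HB.instance Definition _ := gen_choiceMixin P1.

Definition WOT : topologicalType := initial_topology
  (fun T : P1 => (fun yx => dotp yx.1 (T yx.2)) : {ptws (l2 * l2) -> C}).

Definition SOT : topologicalType := initial_topology
  (fun T : P1 => (T : l2 -> l2) : {ptws l2 -> l2}).

(* SOT_* : pointwise norm convergence of the adjoints *)
Definition SOT_lower_star : topologicalType := initial_topology
  (fun T : P1 => (adjoint T : l2 -> l2) : {ptws l2 -> l2}).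

(* SOT^* : the join of SOT and SOT_* *)
Definition SOT_upper_star : topologicalType := initial_topology
  (fun T : P1 => ((T : l2 -> l2) : {ptws l2 -> l2},
                  (adjoint T : l2 -> l2) : {ptws l2 -> l2})).

Lemma initial_cvgP (S : choiceType) (T : topologicalType) (f : S -> T)
    (F : set_system S) (s : S) : Filter F ->
  F --> (s : initial_topology f) <-> f @ F --> f s.
Proof.
move=> FF; split=> [h|h].
  by apply: cvg_trans (@initial_continuous _ _ f s); exact: cvg_app.
move=> A [_ [[B Bo <-] Bfs] sBA]; apply: filterS sBA _.
by apply: h; apply: open_nbhs_nbhs.
Qed.

Lemma ell2_cvgP (S : Type) (F : set_system S) (FF : Filter F) (v : S -> l2)
  (l : l2) : v @ F --> l <-> l2norm (v s - l) @[s --> F] --> (0 : R).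
Proof.
have E s (e : R) : (`|l - v s| < e%:C) = (`|0 - l2norm (v s - l)| < e).
  by rewrite sub0r normrN [in RHS]ger0_norm ?l2norm_ge0// distrC normE ltcR.
split=> [/cvgrPdist_lt h|/cvgrPdist_lt h]; apply/cvgrPdist_lt.
  move=> e e0; have := h e%:C; rewrite ltcR => /(_ e0).
  by apply: filterS => s; rewrite E.
by move=> _ /gt0C[e e0 ->]; apply: filterS (h e e0) => s; rewrite E.
Qed.

Section convergence.
Variables (F : set_system P1) (FF : Filter F) (T : P1).

Lemma WOT_cvgP : F --> (T : WOT) <->
  forall y x, dotp y ((S : P1) x) @[S --> F] --> dotp y (T x).
Proof.
rewrite initial_cvgP pointwise_cvgP; split=> [h y x|h [y x]]; last exact: h.
exact: (h (y, x)).
Qed.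

Lemma SOT_cvgP : F --> (T : SOT) <->
  forall x, l2norm ((S : P1) x - T x) @[S --> F] --> 0.
Proof.
rewrite initial_cvgP pointwise_cvgP.
by split=> h x; move: (h x); rewrite ell2_cvgP.
Qed.

Lemma SOT_lower_star_cvgP : F --> (T : SOT_lower_star) <->
  forall y, l2norm (adjoint (S : P1) y - adjoint T y) @[S --> F] --> 0.
Proof.
rewrite initial_cvgP pointwise_cvgP.
by split=> h x; move: (h x); rewrite ell2_cvgP.
Qed.

Lemma SOT_upper_star_cvgP : F --> (T : SOT_upper_star) <->
  F --> (T : SOT) /\ F --> (T : SOT_lower_star).
Proof.
rewrite !initial_cvgP; split=> [h|[h1 h2]]; last exact: cvg_pair h1 h2.
split; [exact: (cvg_comp _ _ h cvg_fst)|exact: (cvg_comp _ _ h cvg_snd)].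
Qed.

End convergence.

(* only the values of [u] on [J] matter *)
Definition class_M (T : P1) : Prop :=
  opnorm T = 1 /\
  exists (J : set nat) (u : nat -> l2),
    (forall r, J r ->
       [/\ norming (adjoint T) (u r), nonneg_vec (u r) & l2norm (u r) = 1]) /\
    \bigcup_(r in J) Supp (u r) = setT.
End positive_contractions.

(* Main.v *)
Require Import Defs.
From mathcomp Require Import all_boot all_order all_algebra.
From mathcomp Require Import all_classical all_reals all_analysis.
From mathcomp Require Import complex ring lra.

(** Let T be in the class M and let S tend to T in WOT.

    If u is a unit vector norming for the adjoint of T, then the adjoint of T
    sends u to a vector b of norm at least 1, because the adjoint has norm at
    least that of T.  The vectors S^* u lie in the unit ball and tend weakly
    to b, a vector of maximal norm in that ball; in a Hilbert space this
    forces norm convergence ([l2norm_sub_sqr_le], [adjoint_cvg_norming]).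

    Positivity spreads this convergence from u to its support.  If u >= 0 then
    u_j (S^* e_j) <= S^* u coordinatewise ([adjoint_domination]), so when
    u_j > 0 the vectors S^* e_j converge coordinatewise and are dominated by a
    norm convergent family; dominated convergence in ell^2
    ([cvg_l2_dominated]) makes them converge in norm.  The supports cover all
    indices j, and adjoints of contractions that converge in norm on every
    basis vector converge in norm everywhere ([adjoint_cvg_basis]).  This is
    SOT_* convergence.  The second claim follows: SOT convergence implies WOT
    convergence, hence SOT_* convergence, and SOT^* is the join of SOT and
    SOT_*. *)

Local Open Scope classical_set_scope.
Local Open Scope ring_scope.

Set Implicit Arguments.
Unset Strict Implicit.
Unset Printing Implicit Defensive.
Import Order.TTheory GRing.Theory Num.Theory.
Import numFieldNormedType.Exports.
Import ComplexField.Normc.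

(** * Limits along a filter *)

Section filter_limits.
Context (R : realType) (I : Type) (F : set_system I) (FF : Filter F).
Local Notation C := R[i]%C.

Lemma cvg_normcB (v : I -> C) (l : C) :
  v @ F --> l -> normc (v s - l) @[s --> F] --> (0 : R).
Proof.
move=> /cvgrPdist_lt h; apply/cvgrPdist_lt => e e0.
have := h e%:C%C; rewrite ltcR => /(_ e0); apply: filterS => s.
move=> /(etrans (esym (ltc_normE _ _))).
by rewrite sub0r normrN ger0_norm ?normc_ge0// -normcN opprB.
Qed.

(** The uniform approximation argument common to dominated convergence and to
    the extension from basis vectors: first choose N so that q N is small,
    then follow the filter with N fixed. *)
Lemma cvg0_approx (h : I -> R) (p : nat -> I -> R) (q : nat -> R) :
  (forall s, 0 <= h s) -> (forall N s, h s <= p N s + q N) ->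
  (forall N, p N s @[s --> F] --> (0 : R)) -> q @ \oo --> (0 : R) ->
  h s @[s --> F] --> (0 : R).
Proof.
move=> h0 hpq p0 q0; apply/cvgrPdist_lt => e e0.
have e20 : 0 < e / 2 by rewrite divr_gt0.
have /cvgrPdist_lt/(_ _ e20) [N _ /(_ N (leqnn N))] := q0.
rewrite /= sub0r normrN => qN.
have /cvgrPdist_lt/(_ _ e20) := p0 N.
apply: filterS => s; rewrite !sub0r !normrN => pN.
rewrite ger0_norm// (le_lt_trans (hpq N s))//.
have := ler_norm (p N s); have := ler_norm (q N); lra.
Qed.

Lemma cvgD0 (f g : I -> R) : f s @[s --> F] --> (0 : R) ->
  g s @[s --> F] --> (0 : R) -> (f s + g s) @[s --> F] --> (0 : R).
Proof. by move=> f0 g0; rewrite -(addr0 (0 : R)); exact: cvgD. Qed.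

Lemma cvgMl0 (c : R) (f : I -> R) : f s @[s --> F] --> (0 : R) ->
  c * f s @[s --> F] --> (0 : R).
Proof. by move=> f0; rewrite -(mulr0 c); apply: cvgM => //; exact: cvg_cst. Qed.

Lemma cvg_sum0 (f : nat -> I -> R) N :
  (forall k, f k s @[s --> F] --> (0 : R)) ->
  \sum_(0 <= k < N) f k s @[s --> F] --> (0 : R).
Proof.
move=> f0; elim: N => [|N IH].
  by under eq_fun do rewrite big_geq//; exact: cvg_cst.
by under eq_fun do rewrite big_nat_recr//=; exact: cvgD0.
Qed.

End filter_limits.

(** * Geometry of the sequence space *)

Section ell2_geometry.
Context (R : realType).
Local Notation C := R[i]%C.
Local Notation l2 := (ell2 R).
Implicit Types (x y : l2).

Lemma normcE (z : C) : `|z| = (normc z)%:C%C.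
Proof. by case: z. Qed.

Lemma normc_real (r : R) : 0 <= r -> normc (r%:C)%C = r.
Proof. by move=> r0; rewrite /= expr0n /= addr0 sqrtr_sqr ger0_norm. Qed.

Lemma ler_normc (z w : C) : 0 <= z -> z <= w -> normc z <= normc w.
Proof.
move=> z0 zw; rewrite -lecR -!normcE !ger0_norm//.
exact: le_trans zw.
Qed.

Lemma l2norm0 : l2norm (0 : l2) = 0.
Proof. by rewrite -(scale0r (0 : l2)) l2normZ normc0 mul0r. Qed.

Lemma l2normN x : l2norm (- x) = l2norm x.
Proof. by rewrite -scaleN1r l2normZ normcN normc1 mul1r. Qed.

Lemma l2normB x y : l2norm (x - y) <= l2norm x + l2norm y.
Proof. by rewrite (le_trans (l2normD _ _))// l2normN. Qed.

Lemma ler_l2norm x y :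
  (forall n, normc (x n) <= normc (y n)) -> l2norm x <= l2norm y.
Proof.
move=> xy; apply: l2norm_le => [|n]; first exact: l2norm_ge0.
rewrite (le_trans _ (ell2_sqsum_sqrt_le y n))// ler_wsqrtr//.
rewrite /sqsum !seriesEnat; apply: ler_sum => i _.
by rewrite lerXn2r ?nnegrE ?normc_ge0.
Qed.

Definition tail x N : l2 := x - trunc x N.

Lemma tailE x N n : tail x N n = if (n < N)%N then 0 else x n.
Proof.
rewrite -[LHS]/(x n - trunc x N n) truncE.
by case: ifP; rewrite ?subrr ?subr0.
Qed.

Lemma tailD x y N : tail (x + y) N = tail x N + tail y N.
Proof.
apply/val_inj/funext => n; rewrite -[LHS]/(tail (x + y) N n).
rewrite -[RHS]/(tail x N n + tail y N n) !tailE.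
by case: ifP; rewrite ?addr0.
Qed.

Lemma l2norm_tail x N : l2norm (tail x N) <= l2norm x.
Proof.
by apply: ler_l2norm => n; rewrite tailE; case: ifP; rewrite ?normc0 ?normc_ge0.
Qed.

Lemma l2norm_ebasis k : l2norm (ebasis R k) <= 1.
Proof.
apply: l2norm_le => // n; rewrite sqsum_delta -[leRHS]sqrtr1 ler_wsqrtr//.
by case: (k < n)%N.
Qed.

Lemma l2norm_sum (f : nat -> l2) N :
  l2norm (\sum_(0 <= k < N) f k) <= \sum_(0 <= k < N) l2norm (f k).
Proof.
elim: N => [|N IH].
  by rewrite !big_geq// l2norm0.
by rewrite !big_nat_recr//= (le_trans (l2normD _ _))// lerD2r.
Qed.

Lemma dotpB x y (z : l2) : dotp x (y - z) = dotp x y - dotp x z.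
Proof. by rewrite -scaleN1r dotpD dotpZ mulN1r. Qed.

Lemma dotpp x : dotp x x = (l2norm x ^+ 2)%:C%C.
Proof.
have sx : limn (sqsum x) = l2norm x ^+ 2.
  rewrite sqr_sqrtr//.
  by rewrite (le_trans _ (square_summable_le 0%N (@ell2P _ x)))// sqsum_ge0.
apply/cvg_lim => //; apply/cvgC_normc.
have : (fun n => `|l2norm x ^+ 2 - sqsum x n|) @ \oo --> (0 : R).
  rewrite -[X in _ --> X](@normr0 _ R) -(subrr (l2norm x ^+ 2)).
  by apply: cvg_norm; apply: cvgB; [exact: cvg_cst|rewrite -sx; exact: ell2P].
apply: cvg_trans; apply: near_eq_cvg; near=> n.
have -> : series (fun n => (x n)^* * x n)%C n = (sqsum x n)%:C%C.
  rewrite /sqsum !seriesEnat/= rmorph_sum; apply: eq_bigr => i _.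
  by rewrite mulrC -sqr_normc rmorphXn normcE.
by rewrite -rmorphB /= expr0n /= addr0 sqrtr_sqr.
Unshelve. all: by end_near. Qed.

(** Quantitative form of the principle that weak convergence without gain of
    norm is norm convergence: with d = x - y, expanding the squared norm of
    x = d + y gives |d|^2 = |x|^2 - |y|^2 - 2 Re <y, d>. *)
Lemma l2norm_sub_sqr_le x y :
  l2norm x <= l2norm y -> l2norm (x - y) ^+ 2 <= 2 * normc (dotp y (x - y)).
Proof.
rewrite -{1}(subrK y x); move: (x - y) => d yd.
have dD (a b c : l2) : dotp (a + b) c = dotp a c + dotp b c.
  by rewrite dotpC dotpD rmorphD /= -!dotpC.
have : dotp (d + y) (d + y) = dotp y y + dotp y d + (dotp y d)^*%C + dotp d d.
  by rewrite -(dotpC y d) dotpD !dD; ring.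
rewrite !dotpp; move: (normc_geRe (dotp y d)); case: (dotp y d) => a b.
rewrite [complex.Re _]/= => le_a [E].
have : l2norm (d + y) ^+ 2 <= l2norm y ^+ 2.
  by rewrite lerXn2r// nnegrE l2norm_ge0.
have := ler_norm (- a); rewrite normrN.
move: E; lra.
Qed.

(** All terms of the series defining the inner product are nonnegative, so each
    of them is at most every later partial sum, hence at most the limit. *)
Lemma dotp_ge_term x y j : nonneg_vec x -> nonneg_vec y ->
  normc (x j) * normc (y j) <= normc (dotp x y).
Proof.
move=> x0 y0; apply/ler_addgt0Pr => e e0.
have t0 i : 0 <= (x i)^*%C * y i.
  have -> : (x i)^*%C = x i.
    have := x0 i; case: (x i) => a b.
    by rewrite lecE /= => /andP[/eqP -> _]; rewrite oppr0.
  exact: mulr_ge0.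
have /cvgC_normc/cvgrPdist_lt/(_ e e0) [n _ hn] := @is_cvg_dotp _ x y.
(* The partial sum of length [m] contains the term of index [j] and is within
   [e] of the inner product. *)
have := hn (maxn n j.+1) (leq_maxl _ _); set m := maxn _ _.
rewrite /= sub0r normrN ger0_norm ?normc_ge0// => /ltW he.
rewrite -(normc_conj (x j)) -normcM.
apply: (@le_trans _ _ (normc (series (fun n => (x n)^* * y n)%C m))).
  apply: ler_normc => //.
  have jm : (j < m)%N by rewrite leq_max leqnn orbT.
  rewrite seriesEnat /= big_mkord (bigD1 (Ordinal jm))//= lerDl.
  by apply: sumr_ge0 => i _; exact: t0.
set s := series _ m in he *.
rewrite -[s](subKr (dotp x y)) (le_trans (le_normcD _ _))// normcN.
by rewrite lerD2l.
Qed.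

(** Dominated convergence in ell^2 with a moving dominating vector: the tails
    of g s are uniformly small because g s converges in norm, so those of a s
    are too, and below a fixed index only finitely many coordinates matter. *)
Lemma cvg_l2_dominated (I : Type) (F : set_system I) (FF : Filter F)
    (c : R) (a g : I -> l2) (b h : l2) :
  0 < c -> (forall s n, c * normc (a s n) <= normc (g s n)) ->
  l2norm (g s - h) @[s --> F] --> 0 ->
  (forall n, normc (a s n - b n) @[s --> F] --> 0) ->
  l2norm (a s - b) @[s --> F] --> 0.
Proof.
move=> c0 ag gh ab.
pose p N s := \sum_(0 <= k < N) normc (a s k - b k) + c^-1 * l2norm (g s - h).
pose q N := c^-1 * l2norm (tail h N) + l2norm (tail b N).
apply: (@cvg0_approx _ _ _ _ _ p q) => [s|N s|N|].
- exact: l2norm_ge0.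
- have -> : a s - b = trunc (a s - b) N + (tail (a s) N - tail b N).
    have -> : tail (a s) N = tail (a s - b) N + tail b N by rewrite -tailD subrK.
    by rewrite addrK [RHS]addrC /tail subrK.
  rewrite (le_trans (l2normD _ _))// /p /q -[leRHS]addrA lerD//.
    rewrite (le_trans (l2norm_sum _ _))//; apply: ler_sum => k _.
    by rewrite l2normZ -[leRHS]mulr1 ler_wpM2l ?normc_ge0 ?l2norm_ebasis.
  rewrite (le_trans (l2normB _ _))// addrA lerD2r -mulrDr.
  rewrite ler_pdivlMl//.
  have cN : normc (c%:C)%C = c by rewrite normc_real// ltW.
  rewrite -[X in X * _]cN -l2normZ.
  apply: (@le_trans _ _ (l2norm (tail (g s) N))).
    apply: ler_l2norm => n; rewrite -[X in normc X]/(c%:C%C * tail (a s) N n).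
    rewrite normcM cN !tailE; case: ifP => // _.
    by rewrite !normc0 mulr0.
  rewrite -{1}(subrK h (g s)) tailD (le_trans (l2normD _ _))// lerD2r.
  exact: l2norm_tail.
- by apply: cvgD0; [exact: cvg_sum0|exact: cvgMl0].
- by apply: cvgD0; [apply: cvgMl0|]; exact: cvg_trunc.
Qed.

End ell2_geometry.

(** * Adjoints of positive contractions *)

Section operators.
Context (R : realType).
Local Notation C := R[i]%C.
Local Notation l2 := (ell2 R).

Lemma opnorm_ub (T : bounded_op R) x : l2norm x <= 1 -> l2norm (T x) <= opnorm T.
Proof.
move=> x1; apply: ub_le_sup; last by exists x.
have [M M0 hM] := bop_bounded0 T; exists M => _ [y /= y1 <-].
by rewrite (le_trans (hM y))// -[leRHS]mulr1 ler_wpM2l.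
Qed.

Lemma le_opnorm (T : bounded_op R) x : l2norm (T x) <= opnorm T * l2norm x.
Proof.
have [->|x0] := eqVneq x 0; first by rewrite linear0 l2norm0 mulr0.
have nx0 : 0 < l2norm x.
  by rewrite lt_neqAle l2norm_ge0 andbT eq_sym; apply: contra_neq x0 => /l2norm_eq0.
pose r : R := (l2norm x)^-1.
have rN : normc (r%:C)%C = r by rewrite normc_real// invr_ge0 ltW.
rewrite -ler_pdivrMr// mulrC -/r -rN -l2normZ -linearZ /=.
by apply: opnorm_ub; rewrite l2normZ rN mulVf// gt_eqF.
Qed.

(** From |T x|^2 = <T^* T x, x> <= |T^*| |T x| |x|.  It makes a norming
    unit vector of the adjoint be mapped to a vector of norm at least |T|. *)
Lemma opnorm_adjoint_ge (T : bounded_op R) : opnorm T <= opnorm (adjoint T).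
Proof.
apply: ge_sup; first by exists (l2norm (T 0)), 0; rewrite //= l2norm0.
move=> _ [x /= x1 <-].
have [->|Tx0] := eqVneq (l2norm (T x)) 0.
  by rewrite -(l2norm0 R) -(linear0 (adjoint T)) opnorm_ub// l2norm0.
have {}Tx0 : 0 < l2norm (T x) by rewrite lt_neqAle l2norm_ge0 andbT eq_sym.
rewrite -(ler_pM2r Tx0) -expr2.
have -> : l2norm (T x) ^+ 2 = normc (dotp (T x) (T x)).
  by rewrite dotpp normc_real// sqr_ge0.
rewrite adjointP (le_trans (CauchySchwarz_dotp _ _))//.
apply: (@le_trans _ _ (l2norm (adjoint T (T x)))).
  by rewrite -[leRHS]mulr1 ler_wpM2l ?l2norm_ge0.
exact: le_opnorm.
Qed.

Lemma adjoint_contraction (T : P1 R) y : l2norm (adjoint T y) <= l2norm y.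
Proof.
apply: l2norm_le => [|n]; first exact: l2norm_ge0.
rewrite -[leRHS]mul1r; apply: adjoint_seq_le => // x.
rewrite (le_trans (le_opnorm _ _))// ler_wpM2r ?l2norm_ge0//.
exact: P1_contraction.
Qed.

Lemma nonneg_ebasis k : nonneg_vec (ebasis R k).
Proof. by move=> n; rewrite /= ler0n. Qed.

Lemma adjoint_ebasis (T : bounded_op R) j k :
  adjoint T (ebasis R j) k = ((T (ebasis R k) j)^*)%C.
Proof. by rewrite -[LHS]/(dotp (T (ebasis R k)) (ebasis R j)) dotpC dotp_ebasis. Qed.

(** Since u >= u_j e_j and S^* is positive, u_j (S^* e_j) <= S^* u.  The k-th
    coordinates of the two sides are a term and the sum of the series of the
    inner product of S e_k and u, whence the use of [dotp_ge_term]. *)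
Lemma adjoint_domination (S : P1 R) u j k : nonneg_vec u ->
  normc (u j) * normc (adjoint S (ebasis R j) k) <= normc (adjoint S u k).
Proof.
move=> u0; rewrite adjoint_ebasis normc_conj mulrC.
exact: (dotp_ge_term j (@P1_positive _ S _ (nonneg_ebasis k)) u0).
Qed.

(** The adjoints are contractions, so replacing y by its truncation changes
    S^* y - T^* y by at most twice the norm of the tail of y, uniformly in S;
    the truncation is a finite combination of basis vectors. *)
Lemma adjoint_cvg_basis (F : set_system (P1 R)) (FF : Filter F) (T : P1 R) :
  (forall j, l2norm (adjoint (S : P1 R) (ebasis R j) - adjoint T (ebasis R j))
     @[S --> F] --> 0) ->
  F --> (T : SOT_lower_star R).
Proof.
move=> h; apply/SOT_lower_star_cvgP => y.
pose D (S : P1 R) z := adjoint S z - adjoint T z.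
have DD S z w : D S (z + w) = D S z + D S w.
  by rewrite /D !linearD; exact: addrACA.
have DZ S c z : D S (c *: z) = c *: D S z.
  by rewrite /D scalerBr; congr (_ - _); exact: linearZ.
have D0 S : D S 0 = 0 by rewrite /D !linear0 addr0.
pose p N S := \sum_(0 <= k < N) normc (y k) * l2norm (D S (ebasis R k)).
apply: (@cvg0_approx _ _ _ _ _ p (fun N => 2 * l2norm (tail y N))).
- by move=> S; exact: l2norm_ge0.
- move=> N S; rewrite -/(D S y) -{1}(subrK (trunc y N) y) -/(tail y N) addrC.
  rewrite DD (le_trans (l2normD _ _))// lerD//.
    have -> : D S (trunc y N) = \sum_(0 <= k < N) y k *: D S (ebasis R k).
      rewrite /trunc (big_morph (D S) (DD S) (D0 S)).
      by apply: eq_bigr => k _; rewrite DZ.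
    rewrite (le_trans (l2norm_sum _ _))//; apply: ler_sum => k _.
    by rewrite l2normZ.
  rewrite (le_trans (l2normB _ _))// mulr_natl mulr2n.
  by rewrite lerD// adjoint_contraction.
- move=> N; apply: cvg_sum0 => k; apply: cvgMl0; exact: h.
- by apply: cvgMl0; exact: cvg_trunc.
Qed.

(** With b = T^* u, the hypothesis and contractivity give |S^* u| <= |b|, so
    [l2norm_sub_sqr_le] bounds |S^* u - b|^2 by twice the modulus of
    <b, S^* u - b>, which is the conjugate of <u, S b> - <u, T b>: a WOT
    null quantity. *)
Lemma adjoint_cvg_norming (F : set_system (P1 R)) (FF : Filter F) (T : P1 R) u :
  F --> (T : WOT R) -> l2norm u <= l2norm (adjoint T u) ->
  l2norm (adjoint (S : P1 R) u - adjoint T u) @[S --> F] --> 0.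
Proof.
move=> /WOT_cvgP h Tu; set b := adjoint T u.
have w : normc (dotp u ((S : P1 R) b) - dotp u (T b)) @[S --> F] --> 0.
  by apply: cvg_normcB; exact: h.
apply: (@squeeze_cvgr _ _ _ _ (cst 0) (fun S : P1 R =>
    Num.sqrt (2 * normc (dotp u (S b) - dotp u (T b))))).
- apply: nearW => S; rewrite l2norm_ge0 /=.
  rewrite -[leLHS]ger0_norm ?l2norm_ge0// -sqrtr_sqr ler_wsqrtr//.
  have := @l2norm_sub_sqr_le _ (adjoint S u) b.
  rewrite (le_trans (adjoint_contraction _ _) Tu) => /(_ isT).
  rewrite -[in X in _ <= X -> _]normc_conj.
  by rewrite dotpB rmorphB /= -!dotpC !adjointP.
- exact: cvg_cst.
- rewrite -(sqrtr0 R).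
  apply: (@cvg_comp _ _ _ (fun S : P1 R => 2 * normc (dotp u (S b) - dotp u (T b)))
    Num.sqrt); last exact: sqrt_continuous.
  exact: cvgMl0.
Qed.

Lemma class_M_cvg (F : set_system (P1 R)) (FF : Filter F) (T : P1 R) :
  class_M T -> F --> (T : WOT R) -> F --> (T : SOT_lower_star R).
Proof.
move=> [T1 [J [u [hu hS]]]] FT; apply: adjoint_cvg_basis => j.
have [r Jr] : (\bigcup_(r in J) Supp (u r)) j by rewrite hS.
rewrite /Supp /= dotp_ebasis => urj.
have [[_ nu] u0 u1] := hu r Jr.
apply: (@cvg_l2_dominated _ _ _ _ (normc (u r j))
   (fun S : P1 R => adjoint S (ebasis R j)) (fun S : P1 R => adjoint S (u r))
   _ (adjoint T (u r))).
- rewrite lt_neqAle normc_ge0 andbT eq_sym.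
  by apply: contra_neq urj => /eq0_normc.
- by move=> S k; exact: adjoint_domination.
- apply: adjoint_cvg_norming => //.
  by rewrite nu u1 mulr1 -T1 opnorm_adjoint_ge.
- move=> k; have /WOT_cvgP/(_ (ebasis R j) (ebasis R k))/cvg_normcB := FT.
  apply: cvg_trans; apply: near_eq_cvg; apply: nearW => S.
  by rewrite !adjoint_ebasis !dotp_ebasis -normc_conj rmorphB.
Qed.

Lemma SOT_cvg_WOT (F : set_system (P1 R)) (FF : Filter F) (T : P1 R) :
  F --> (T : SOT R) -> F --> (T : WOT R).
Proof.
move=> /SOT_cvgP h; apply/WOT_cvgP => y x.
apply/cvgrPdist_lt => _ /gt0C[e e0 ->].
have : l2norm y * l2norm ((S : P1 R) x - T x) @[S --> F] --> 0.
  by apply: cvgMl0.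
move=> /cvgrPdist_lt/(_ e e0); apply: filterS => S.
rewrite sub0r normrN ger0_norm ?mulr_ge0 ?l2norm_ge0// => lt_e.
rewrite distrC; apply: (etrans (ltc_normE _ _)).
apply: le_lt_trans lt_e.
by rewrite -dotpB CauchySchwarz_dotp.
Qed.

End operators.

Theorem theorem1p8 (R : realType) (T : P1 R) (hT : class_M T) :
  {for T, continuous ((fun S => S) : WOT R -> SOT_lower_star R)} /\
  {for T, continuous ((fun S => S) : SOT R -> SOT_upper_star R)}.
Proof.
have hW : nbhs (T : WOT R) --> (T : SOT_lower_star R) by apply: class_M_cvg hT _.
have hS : nbhs (T : SOT R) --> (T : SOT_upper_star R).
  apply/SOT_upper_star_cvgP; split; first exact: cvg_id.
  by apply: class_M_cvg => //; apply: SOT_cvg_WOT; exact: cvg_id.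
by split; [exact: hW|exact: hS].
Qed.
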